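(* Let $\alpha\in(-1,0]$. If $v=(v_n)_{n\ge0}$ is a real sequence with $v=v^+\not\equiv0$ (that is, $v_n\ge0$ for all $n$ and $v_n\neq0$ for some $n$), then $\kappa_-(H_{\alpha,V})\ge1$.
   Context: For $\alpha>-1$ and a complex sequence $u=(u_n)_{n\ge 0}$ (with $u_{-1}:=0$) put $$(\tau_\alpha u)_n=-\sqrt{n(n+\alpha)}\,u_{n-1}+(2n+1+\alpha)u_n-\sqrt{(n+1)(n+1+\alpha)}\,u_{n+1},\quad n\ge 0.$$ For a real sequence $v=(v_n)_{n\ge0}$, $V$ is multiplication by $v$, $(Vu)_n=v_nu_n$, and $H_{\alpha,V}=H_\alpha-V$ is the maximal operator $u\mapsto\tau_\alpha u-Vu$ on $\{u\in\ell^2(\mathbb{Z}_{\ge0}):\tau_\alpha u-Vu\in\ell^2(\mathbb{Z}_{\ge0})\}$, which is self-adjoint in $\ell^2(\mathbb{Z}_{\ge0})$ (for $v=0$ it is the discrete Laguerre operator $H_\alpha$, which is nonnegative). $v^+:=(|v|+v)/2$. $\kappa_-(H_{\alpha,V})$ is the total multiplicity of the negative spectrum of $H_{\alpha,V}$, i.e. the dimension of the range of its spectral projection onto $(-\infty,0)$. *)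

(* Defs.v *)
From HB Require Import structures.
From mathcomp Require Import all_boot all_order all_algebra.
From mathcomp Require Import complex.
From mathcomp Require Import all_classical all_reals all_analysis.

Set Implicit Arguments.
Unset Strict Implicit.
Unset Printing Implicit Defensive.

Import Order.TTheory GRing.Theory Num.Theory.
Import numFieldNormedType.Exports.

Local Open Scope classical_set_scope.
Local Open Scope ring_scope.

Section Ell2.
Variable R : realType.

Definition cseq := nat -> R[i].

Implicit Types u w : cseq.

Definition normsq u : \bar R :=
  (\sum_(0 <= n <oo) (Normc.normc (u n) ^+ 2)%:E)%E.

Definition ell2 : set cseq := [set u | (normsq u < +oo)%E].

(* For u, w in ell2 both real series converge absolutely, so this is the usual
   inner product \sum_n u_n * conj (w_n); [limn] is only meaningful there. *)
Definition inner u w : R[i] :=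
  Complex (limn (series (fun n => complex.Re (u n * conjc (w n)))))
          (limn (series (fun n => complex.Im (u n * conjc (w n))))).

(* An unbounded operator in ell2; values of [act] outside [dom] are irrelevant. *)
Record operator := Operator { dom : set cseq ; act : cseq -> cseq }.

Definition orth_projection (P : cseq -> cseq) : Prop :=
  [/\ forall u, ell2 u -> ell2 (P u),
      forall (c : R[i]) u w, ell2 u -> ell2 w -> P (c *: u + w) = c *: P u + P w,
      forall u, ell2 u -> P (P u) = P u &
      forall u w, ell2 u -> ell2 w -> inner (P u) w = inner u (P w)].

(* Only the values on Borel sets and on vectors of ell2 are constrained.
   Strong countable additivity of projections gives E set0 = 0 and
   E (A `&` B) = E A \o E B. *)
Definition projection_valued_measure
    (E : set (measurableTypeR R) -> cseq -> cseq) : Prop :=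
  [/\ forall B, measurable B -> orth_projection (E B),
      forall u, ell2 u -> E setT u = u &
      forall B : (set (measurableTypeR R))^nat,
        (forall k, measurable (B k)) -> trivIset setT B ->
        forall u, ell2 u ->
          (fun n => normsq (E (\bigcup_k B k) u - \sum_(k < n) E (B k) u))
            @ \oo --> 0%E].

(* B |-> <E(B)u, u>, which equals ||E(B)u||^2 as E(B) is an orthogonal
   projection. *)
Definition scalar_measure (E : set (measurableTypeR R) -> cseq -> cseq) u
    (B : set (measurableTypeR R)) : \bar R := normsq (E B u).

(* A = \int x dE(x): the domain of A consists of the u in ell2 with
   \int x^2 d<E(x)u,u> < oo, and <Au,u> = \int x d<E(x)u,u> on it. By
   polarization on the dense subspace dom A, the quadratic form determines the
   linear operator A. *)
Definition spectral_measure_of (A : operator)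
    (E : set (measurableTypeR R) -> cseq -> cseq) : Prop :=
  [/\ projection_valued_measure E,
      dom A = [set u | ell2 u /\
        (\int[scalar_measure E u]_x ((x : R) ^+ 2)%:E < +oo)%E] &
      forall u, dom A u -> inner (act A u) u =
        Complex (fine (\int[scalar_measure E u]_x (x : R)%:E)%E) 0].

Definition lin_indep (n : nat) (b : 'I_n -> cseq) : Prop :=
  forall c : 'I_n -> R[i],
    \sum_(i < n) c i *: b i = 0 -> forall i, c i = 0.

(* All infinite dimensions are identified, with value +oo. *)
Definition dimension (S : set cseq) : \bar R :=
  ereal_sup [set (n%:R)%:E | n in
    [set n : nat | exists b : 'I_n -> cseq, (forall i, S (b i)) /\ lin_indep b]].

(* kappa_-(A), computed from the spectral measure E of A. *)
Definition kappa_minus (E : set (measurableTypeR R) -> cseq -> cseq) : \bar R :=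
  dimension (E [set x : R | x < 0] @` ell2).

End Ell2.

Section Laguerre.
Variable R : realType.

Definition tau (alpha : R) (u : cseq R) : cseq R := fun n =>
  - (Num.sqrt (n%:R * (n%:R + alpha)))%:C%C * (if n is m.+1 then u m else 0)
  + (2 * n%:R + 1 + alpha)%:C%C * u n
  - (Num.sqrt (n.+1%:R * (n.+1%:R + alpha)))%:C%C * u n.+1.

Definition mulV (v : nat -> R) (u : cseq R) : cseq R := fun n => (v n)%:C%C * u n.

Definition H (alpha : R) (v : nat -> R) : operator R :=
  @Operator R [set u | ell2 u /\ ell2 (tau alpha u - mulV v u)]
              (fun u => tau alpha u - mulV v u).

Definition pos_part (v : nat -> R) : nat -> R := fun n => (`|v n| + v n) / 2.

End Laguerre.

(* Main.v *)
Require Import Defs.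
From mathcomp Require Import all_boot all_order all_algebra.
From mathcomp Require Import complex ring lra.
From mathcomp Require Import all_classical all_reals all_analysis.

Import Order.TTheory GRing.Theory Num.Theory.
Import numFieldNormedType.Exports.
Import HBNNSimple.

Local Open Scope classical_set_scope.
Local Open Scope ring_scope.

(** If the range of the spectral projection [E (-oo, 0)] were trivial, the
    quadratic form of [H alpha v] would be nonnegative on its domain, being
    [\int x d<E(x)u,u>] with no mass on [x < 0]
    ([spectral_integral_ge0]).  So it suffices to find a finitely supported
    real [r] on which the form is negative.

    The unperturbed form is a sum of squares,
    [<tau r, r> = \sum_n (sqrt(n+1+alpha) r_n - sqrt(n+1) r_(n+1))^2]
    ([sum_tau_real]).  All the squares vanish for the positive sequence [phi]
    of [ground_state], and for a cut-off [r = phi w] they become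
    [(n+1+alpha) phi_n^2 (w_n - w_(n+1))^2].  When [alpha <= 0] one has
    [phi <= 1], so the weights are at most [n+1]; since the sum of their
    inverses diverges, the form is critical.  Concretely, letting [w] decrease
    from 1 to 0 linearly in the harmonic sum [h_n], up to index [M], gives
    energy at most [1 / h_M] ([cutoff_energy]), which tends to 0, while [r]
    stays bounded below at any fixed site.  Hence no positive multiple of [r_(n0)^2]
    is dominated by the form ([critical]), and subtracting a potential
    [v >= 0] with [v n0 > 0] makes it negative somewhere. *)

(** * Square-summable sequences *)

Lemma sqr_normc_ge0 (R : realType) (z : R[i]) :
  (0 <= (Normc.normc z ^+ 2)%:E)%E.
Proof. by rewrite lee_fin sqr_ge0. Qed.

Lemma normsq0 (R : realType) : normsq (0 : cseq R) = 0%E.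
Proof. by apply: eseries0 => n _ _; rewrite Normc.normc0 expr0n. Qed.

Lemma ell2_0 (R : realType) : ell2 (0 : cseq R).
Proof. by rewrite /ell2 /= normsq0 ltry. Qed.

Lemma normsq_eq0 (R : realType) (u : cseq R) : (normsq u <= 0)%E -> u = 0.
Proof.
move=> u0; apply/funext => m; apply: Normc.eq0_normc.
have : ((\sum_(0 <= k < m.+1) (Normc.normc (u k) ^+ 2)%:E) <= 0)%E.
  apply: le_trans u0; apply: nneseries_lim_ge => *; exact: sqr_normc_ge0.
rewrite sumEFin lee_fin big_nat_recr //= => h.
apply/eqP; rewrite -sqrf_eq0 eq_le sqr_ge0 andbT; apply: le_trans h.
by rewrite lerDr; apply: sumr_ge0 => i _; exact: sqr_ge0.
Qed.

(** Indices start at 2 because this is applied to partial sums over families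
    of sets in which only the first two members may be nonempty. *)
Lemma normsq_cvg0_eq0 (R : realType) (f : nat -> cseq R) (g : cseq R) :
  (fun n => normsq (f n)) @ \oo --> 0%E ->
  (forall n, normsq g <= normsq (f n.+2))%E -> g = 0.
Proof.
move=> f0 gf; apply: normsq_eq0.
rewrite -(cvg_lim (@ereal_hausdorff R) f0).
apply: lime_ge; first by apply/cvg_ex; exists 0%E.
by exists 2%N => // -[|[|n]].
Qed.

Lemma ell2_finite (R : realType) (u : cseq R) (N : nat) :
  (forall n, (N <= n)%N -> u n = 0) -> ell2 u.
Proof.
move=> u0; rewrite /ell2 /= /normsq (nneseries_split 0 N); last first.
  by move=> *; exact: sqr_normc_ge0.
rewrite eseries0 => [|i Ni _]; last by rewrite u0 // Normc.normc0 expr0n.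
by rewrite sumEFin adde0 ltry.
Qed.

(** [mu] is an arbitrary set function: the negative part of the integral is a
    supremum over nonnegative simple functions supported in
    [[set x | f x < 0]], so its vanishing only involves subsets of that set. *)
Lemma integral_ge0_null_neg d (T : measurableType d) (R : realType)
    (mu : set T -> \bar R) (f : T -> R) :
  mu set0 = 0%E ->
  (forall B, measurable B -> B `<=` [set x | f x < 0] -> mu B = 0%E) ->
  (0 <= \int[mu]_x (f x)%:E)%E.
Proof.
move=> mu0 muneg; rewrite /integral; apply: adde_ge0.
  apply: ereal_sup_ubound; exists nnsfun0 => [x|] /=.
    by rewrite funeposE le_max lexx orbT.
  rewrite sintegralET; apply: fsbig1 => x _.
  have [->|x0] := eqVneq x 0; first by rewrite mul0e.
  rewrite (_ : _ @^-1` _ = set0) ?mu0 ?mule0 //.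
  by apply/seteqP; split=> // y /= h; move: x0; rewrite -h eqxx.
rewrite oppe_ge0; apply: ge_ereal_sup => _ [h /= hle <-].
rewrite sintegralET fsbig1 // => x _.
have [->|x0] := eqVneq x 0; first by rewrite mul0e.
rewrite muneg ?mule0 //.
move=> y hy; rewrite /= ltNge; apply/negP => y0.
have := hle y; rewrite [h y]hy.
rewrite funenegE patch_setT -EFinN -EFin_max lee_fin.
rewrite max_r ?oppr_le0 // => x_le0.
have : 0 <= h y by [].
by rewrite hy le_eqVlt eq_sym (negbTE x0) /= ltNge x_le0.
Qed.

(** * Projection-valued measures *)

Section Projections.
Variables (R : realType) (E : set (measurableTypeR R) -> cseq R -> cseq R).
Hypothesis pvmE : projection_valued_measure E.

Lemma proj0 (P : cseq R -> cseq R) : orth_projection P -> P 0 = 0.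
Proof.
case=> _ lin _ _; have := lin 1 0 0 (ell2_0 R) (ell2_0 R).
rewrite scaler0 add0r scale1r => /eqP.
by rewrite -subr_eq0 opprD addrA addrN add0r oppr_eq0 => /eqP.
Qed.

Lemma projN (P : cseq R -> cseq R) u :
  orth_projection P -> ell2 u -> P (- u) = - P u.
Proof.
move=> pP u2; case: (pP) => _ lin _ _; have := lin (-1) u 0 u2 (ell2_0 R).
by rewrite scaleN1r addr0 => ->; rewrite scaleN1r proj0 // addr0.
Qed.

(** For the constant family of empty sets the n-th defect is
    [(1 - n) E(set0)u], whose norm for [n >= 2] is at least that of
    [E(set0)u]. *)
Lemma pvm_set0 u : ell2 u -> E set0 u = 0.
Proof.
move=> u2; case: pvmE => _ _ sadd.
have triv : trivIset [set: nat] (fun=> @set0 (measurableTypeR R)).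
  exact: trivIset_set0.
have := sadd (fun=> set0) (fun=> measurable0) triv u u2.
rewrite bigcup0 // => /normsq_cvg0_eq0; apply => n.
apply: lee_nneseries => [*|m _]; first exact: sqr_normc_ge0.
rewrite lee_fin sumr_const card_ord mulrS opprD addrA addrN add0r.
have -> : (- (E set0 u *+ n.+1)) m = - (E set0 u m *+ n.+1).
  by congr (- _); elim: n.+1 => // k IH; rewrite !mulrS -IH.
rewrite normcN normcMn.
have h : 0 <= Normc.normc (E set0 u m) by case: (E set0 u m) => a b; exact: sqrtr_ge0.
rewrite lerXn2r ?nnegrE ?mulrn_wge0 //.
by rewrite mulrS lerDl mulrn_wge0.
Qed.

Lemma pvm_setU A B u : measurable A -> measurable B -> A `&` B = set0 ->
  ell2 u -> E (A `|` B) u = E A u + E B u.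
Proof.
move=> mA mB AB u2; case: pvmE => _ _ sadd.
have mAB k : measurable (bigcup2 A B k) by case: k => [|[|k]] //=.
have triv : trivIset [set: nat] (bigcup2 A B) by rewrite -trivIset_bigcup2.
have := sadd _ mAB triv u u2; rewrite bigcup2E => /normsq_cvg0_eq0 cvg0.
apply/eqP; rewrite -subr_eq0; apply/eqP/cvg0 => n.
rewrite big_ord_recl big_ord_recl big1 ?addr0 //= => i _.
by rewrite /bigcup2 /= pvm_set0.
Qed.

(** The complementary projections [P = E A] and [Q = E (N \ A)] satisfy
    [P + Q = 0]; then [P = - Q = - Q Q = - P P = - P], so [P = 0]. *)
Lemma pvm_null_subset N A : measurable N -> measurable A -> A `<=` N ->
  (forall u, ell2 u -> E N u = 0) -> forall u, ell2 u -> E A u = 0.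
Proof.
move=> mN mA AN EN0.
have mD : measurable (N `\` A) by exact: measurableD.
case: (pvmE) => projE _ _.
have [pA pD] := (projE _ mA, projE _ mD).
have opp u : ell2 u -> E (N `\` A) u = - E A u.
  move=> u2; apply/eqP; rewrite -addr_eq0 addrC -pvm_setU ?setDIK //.
  by rewrite setDUK // EN0.
move=> u u2; have [ellA _ idA _] := pA; have [_ _ idD _] := pD.
have := idD u u2; rewrite (opp u u2) projN //; last exact: ellA.
rewrite (opp _ (ellA u u2)) opprK idA // => /eqP.
rewrite -addr_eq0 => /eqP twice0; apply/funext => m; apply/eqP.
have : E A u m + E A u m = 0.
  by rewrite -[LHS]/((E A u + E A u) m) twice0.
by rewrite -mulr2n => /eqP; rewrite mulrn_eq0.
Qed.

Lemma spectral_integral_ge0 (u : cseq R) :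
  (forall w, ell2 w -> E [set x | x < 0] w = 0) -> ell2 u ->
  (0 <= \int[scalar_measure E u]_x (x : R)%:E)%E.
Proof.
move=> E0 u2; have mneg : measurable ([set x | x < 0] : set (measurableTypeR R)).
  by have := measurable_itv (`]-oo, 0[ : interval R); rewrite set_itvE.
apply: integral_ge0_null_neg => [|B mB Bneg].
  by rewrite /scalar_measure pvm_set0 // normsq0.
by rewrite /scalar_measure (pvm_null_subset _ _ mneg mB Bneg E0 _ u2) normsq0.
Qed.
End Projections.

(** * The quadratic form of the Laguerre operator *)

Section Form.
Context {R : realType}.
Implicit Types (alpha : R) (r v : nat -> R).

Definition real_seq r : cseq R := fun n => (r n)%:C%C.

Definition tau_real alpha r : nat -> R := fun n =>
  - Num.sqrt (n%:R * (n%:R + alpha)) * (if n is m.+1 then r m else 0)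
  + (2 * n%:R + 1 + alpha) * r n
  - Num.sqrt (n.+1%:R * (n.+1%:R + alpha)) * r n.+1.

Lemma tau_real_seq alpha r : tau alpha (real_seq r) = real_seq (tau_real alpha r).
Proof.
apply/funext => n; rewrite /tau /real_seq /tau_real.
by case: n => [|n]; apply/eqP; rewrite eq_complex /=; apply/andP; split; apply/eqP; ring.
Qed.

(** The first-order operator [A] with [tau = A^* A]. *)
Definition laguerre_diff alpha r : nat -> R := fun n =>
  Num.sqrt (n.+1%:R + alpha) * r n - Num.sqrt n.+1%:R * r n.+1.

(** The boundary term of the summation by parts in [tau_real_mul]. *)
Definition laguerre_flux alpha r : nat -> R := fun n =>
  if n is m.+1 then Num.sqrt m.+1%:R * laguerre_diff alpha r m * r m.+1 else 0.

Lemma natD_gt0 alpha n : -1 < alpha -> 0 < n.+1%:R + alpha.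
Proof.
by move=> a1; have := ler0n R n; rewrite -natr1; lra.
Qed.

Lemma tau_real_mul alpha r n : -1 < alpha ->
  tau_real alpha r n * r n =
  laguerre_diff alpha r n ^+ 2
    + (laguerre_flux alpha r n.+1 - laguerre_flux alpha r n).
Proof.
move=> a1; rewrite /tau_real /laguerre_flux.
have sqn m : Num.sqrt (m.+1%:R : R) ^+ 2 = m.+1%:R by rewrite sqr_sqrtr.
have sqa m : Num.sqrt (m.+1%:R + alpha) ^+ 2 = m.+1%:R + alpha.
  by rewrite sqr_sqrtr // ltW // natD_gt0.
rewrite !sqrtrM ?ler0n //.
case: n => [|n].
  have -> : 2 * 0%:R + 1 + alpha = Num.sqrt (1%:R + alpha) ^+ 2.
    by rewrite sqa; ring.
  by rewrite /laguerre_diff; ring.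
have -> : 2 * n.+1%:R + 1 + alpha =
    Num.sqrt n.+1%:R ^+ 2 + Num.sqrt (n.+2%:R + alpha) ^+ 2.
  by rewrite sqa sqn -[n.+2%:R]natr1; ring.
by rewrite /laguerre_diff; ring.
Qed.

Lemma sum_tau_real alpha r M : -1 < alpha -> r M = 0 ->
  \sum_(n < M) tau_real alpha r n * r n =
  \sum_(n < M) laguerre_diff alpha r n ^+ 2.
Proof.
move=> a1 rM; under eq_bigr => n _ do rewrite tau_real_mul //.
rewrite big_split /= -(big_mkord xpredT
  (fun n => laguerre_flux alpha r n.+1 - laguerre_flux alpha r n)).
rewrite telescope_sumr //.
rewrite subr0; case: M rM => [_|m rM] /=; first by rewrite addr0.
by rewrite rM mulr0 addr0.
Qed.

Lemma Re_inner_real_seq r s M : (forall n, (M <= n)%N -> s n = 0) ->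
  complex.Re (inner (real_seq r) (real_seq s)) = \sum_(n < M) r n * s n.
Proof.
move=> s0; rewrite /inner /=.
apply: lim_near_cst; first exact: Rhausdorff.
exists M => // n /= Mn; rewrite /series /= big_mkord.
rewrite (big_ord_widen n (fun i => r i * s i) Mn) [RHS]big_mkcond /=.
apply: eq_bigr => i _; rewrite mul0r subr0.
by case: ltnP => // /s0 ->; rewrite mulr0.
Qed.

Lemma Re_inner_H alpha v r M : -1 < alpha -> (forall n, (M <= n)%N -> r n = 0) ->
  complex.Re (inner (act (H alpha v) (real_seq r)) (real_seq r)) =
  \sum_(n < M) laguerre_diff alpha r n ^+ 2 - \sum_(n < M) v n * r n ^+ 2.
Proof.
move=> a1 r0; rewrite -sum_tau_real //; last exact: r0.
have -> : act (H alpha v) (real_seq r) =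
          real_seq (fun n => tau_real alpha r n - v n * r n).
  rewrite /= tau_real_seq; apply/funext => n.
  by rewrite [RHS]rmorphB /= rmorphM.
rewrite (Re_inner_real_seq _ _ _ r0) -sumrB.
by apply: eq_bigr => n _; rewrite mulrBl expr2 mulrA.
Qed.

Lemma dom_H_finite alpha v r M : (forall n, (M <= n)%N -> r n = 0) ->
  dom (H alpha v) (real_seq r).
Proof.
move=> r0; split; first by apply: (ell2_finite _ _ M) => n /r0 rn0; rewrite /real_seq rn0.
apply: (ell2_finite _ _ M.+1) => -[//|n] Mn.
rewrite tau_real_seq -[LHS]/(real_seq (tau_real alpha r) n.+1 - mulV v (real_seq r) n.+1).
have [r1 r2 r3] : [/\ r n = 0, r n.+1 = 0 & r n.+2 = 0].
  have Mn' : (M <= n)%N by [].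
  by split; apply: r0; rewrite // !leqW.
by rewrite /mulV /real_seq /tau_real r1 r2 r3 !(mulr0, subr0, addr0, rmorph0).
Qed.

(** * Criticality for nonpositive alpha *)

(** The solution of [laguerre_diff alpha r = 0] with [r 0 = 1]; for
    [alpha > -1] its square is the weight [(1 + alpha)_n / n!]. *)
Definition ground_state alpha : nat -> R := fun n =>
  \prod_(k < n) (Num.sqrt (k.+1%:R + alpha) / Num.sqrt k.+1%:R).

Lemma ground_stateS alpha n :
  ground_state alpha n.+1 * Num.sqrt n.+1%:R =
  ground_state alpha n * Num.sqrt (n.+1%:R + alpha).
Proof.
by rewrite /ground_state big_ord_recr /= -mulrA divfK.
Qed.

Lemma ground_state_gt0 alpha n : -1 < alpha -> 0 < ground_state alpha n.
Proof.
by move=> a1; apply: prodr_gt0 => k _; rewrite divr_gt0 // sqrtr_gt0 ?natD_gt0.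
Qed.

Lemma ground_state_le1 alpha n : alpha <= 0 -> ground_state alpha n <= 1.
Proof.
move=> a0; apply: prodr_ile1 => k _.
rewrite divr_ge0 ?sqrtr_ge0 //= ler_pdivrMr ?sqrtr_gt0 ?ltr0n // mul1r.
by rewrite ler_sqrt ?ler0n // gerDl.
Qed.

Lemma harmonic_series_le : {homo series (@harmonic R) : m n / (m <= n)%N >-> m <= n}.
Proof.
apply/nondecreasing_seqP => n; rewrite -subr_ge0 seriesSB.
exact: harmonic_ge0.
Qed.

Lemma harmonic_series_unbounded (x : R) : exists n, x < series (@harmonic R) n.
Proof.
have /cvgryPgt/(_ x) [n _ hn] :=
  nondecreasing_dvgn_lt harmonic_series_le (@dvg_harmonic R).
by exists n; apply: hn => /=.
Qed.

(** Ground state substitution: relative to [ground_state], the first-order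
    operator is a weighted difference. *)
Lemma laguerre_diff_ground_state alpha w n :
  laguerre_diff alpha (fun k => ground_state alpha k * w k) n =
  Num.sqrt (n.+1%:R + alpha) * ground_state alpha n * (w n - w n.+1).
Proof.
rewrite /laguerre_diff [in X in _ - X]mulrA [_ * ground_state alpha n.+1]mulrC.
by rewrite ground_stateS; ring.
Qed.

(** The increments are [1 / ((n + 1) h_M)], inversely proportional to the
    weights [n + 1] of the form [\sum_n (n + 1) (w_n - w_(n+1))^2]: this
    minimizes it among the [w] going from 1 at 0 to 0 at [M]. *)
Definition log_cutoff (M : nat) : nat -> R := fun n =>
  if (n < M)%N then 1 - series harmonic n / series harmonic M else 0.

Lemma log_cutoff_diff M n : 0 < series (@harmonic R) M -> (n < M)%N ->
  log_cutoff M n - log_cutoff M n.+1 = harmonic n / series harmonic M.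
Proof.
move=> hM nM; rewrite /log_cutoff nM.
have hS : series (@harmonic R) n.+1 = series harmonic n + harmonic n.
  by apply/eqP; rewrite addrC -subr_eq seriesSB.
case: ltnP => [_|Mn]; first by rewrite hS; ring.
have -> : M = n.+1 by apply/eqP; rewrite eqn_leq nM Mn.
rewrite subr0 -[X in X - _](@divff _ (series (@harmonic R) n.+1)).
  by rewrite -mulrBl seriesSB.
by rewrite (_ : n.+1 = M) ?gt_eqF //; apply/eqP; rewrite eqn_leq nM Mn.
Qed.

(** Each squared difference is at most [(n+1) (1 / ((n+1) h_M))^2], and
    the sum of these is [h_M / h_M^2]. *)
Lemma cutoff_energy alpha M : -1 < alpha -> alpha <= 0 ->
  0 < series (@harmonic R) M ->
  \sum_(n < M)
    laguerre_diff alpha (fun k => ground_state alpha k * log_cutoff M k) n ^+ 2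
  <= (series harmonic M)^-1.
Proof.
move=> a1 a0 hM; set S := series harmonic M.
have -> : S^-1 = \sum_(n < M) harmonic n / S ^+ 2.
  have sumS : \sum_(n < M) harmonic n = S by rewrite /S /series /= big_mkord.
  by rewrite -mulr_suml sumS; field; rewrite gt_eqF.
apply: ler_sum => n _; rewrite laguerre_diff_ground_state log_cutoff_diff //.
rewrite -/S !exprMn mulrA [S^-1 ^+ 2]exprVn.
apply: ler_wpM2r; first by rewrite invr_ge0 sqr_ge0.
have hn : n.+1%:R * harmonic n = 1 :> R by rewrite divff.
suff bound : Num.sqrt (n.+1%:R + alpha) ^+ 2 * ground_state alpha n ^+ 2
             <= n.+1%:R.
  apply: le_trans (ler_wpM2r (sqr_ge0 _) bound) _.
  by rewrite expr2 mulrA hn mul1r.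
rewrite sqr_sqrtr; last by rewrite ltW // natD_gt0.
rewrite -[leRHS]mulr1; apply: ler_pM.
- by rewrite ltW // natD_gt0.
- exact: sqr_ge0.
- by rewrite gerDl.
- by rewrite expr_le1 ?ground_state_le1 // ltW // ground_state_gt0.
Qed.

(** Criticality: the form dominates no positive potential, not even one
    supported at a single site, since the cut-offs of the ground state tend to
    it pointwise while their energies tend to 0. *)
Lemma critical alpha n0 (c : R) : -1 < alpha -> alpha <= 0 -> 0 < c ->
  exists r M, [/\ (n0 < M)%N, forall n, (M <= n)%N -> r n = 0 &
    \sum_(n < M) laguerre_diff alpha r n ^+ 2 < c * r n0 ^+ 2].
Proof.
move=> a1 a0 c0; set g := ground_state alpha n0.
have g0 : 0 < g by exact: ground_state_gt0.
have cg0 : 0 < c * g ^+ 2 / 4 by rewrite divr_gt0 // mulr_gt0 // exprn_gt0.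
set s0 := series (@harmonic R) n0.
have s00 : 0 <= s0.
  by rewrite /s0 /series /=; apply: sumr_ge0 => i _; exact: harmonic_ge0.
(* The first summand keeps the cut-off above 1/2 at n0, the second makes
   the energy smaller than c g^2 / 4. *)
have [M hM] := harmonic_series_unbounded (2 * s0 + (c * g ^+ 2 / 4)^-1).
have ic0 : 0 < (c * g ^+ 2 / 4)^-1 by rewrite invr_gt0.
have S0 : 0 < series (@harmonic R) M by lra.
have n0M : (n0 < M)%N.
  rewrite ltnNge; apply/negP => /harmonic_series_le; rewrite -/s0; lra.
exists (fun k => ground_state alpha k * log_cutoff M k), M; split => //.
  by move=> n Mn; rewrite /log_cutoff ltnNge Mn mulr0.
apply: le_lt_trans (cutoff_energy _ _ a1 a0 S0) _.
have half : 1 / 2 <= log_cutoff M n0.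
  rewrite /log_cutoff n0M -/s0; have : s0 / series harmonic M <= 1 / 2; last by lra.
  by rewrite ler_pdivrMr //; lra.
apply: (@lt_le_trans _ _ (c * g ^+ 2 / 4)).
  by rewrite invf_plt ?posrE //; lra.
rewrite exprMn -/g [leRHS]mulrA; apply: ler_wpM2l.
  by rewrite mulr_ge0 ?sqr_ge0 // ltW.
by nra.
Qed.
End Form.

Theorem lemma5p3 (R : realType) (alpha : R) (v : nat -> R)
    (E : set (measurableTypeR R) -> cseq R -> cseq R) :
  -1 < alpha -> alpha <= 0 ->
  v = pos_part v -> (exists n, v n != 0) ->
  spectral_measure_of (H alpha v) E ->
  (1%:E <= kappa_minus E)%E.
Proof.
move=> a1 a0 vpos [n0 vn0] [pvmE _ formE].
have v_ge0 n : 0 <= v n.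
  by rewrite vpos /pos_part; have := ler_norm (- v n); rewrite normrN; lra.
have [u u2 Eu] : exists2 u, ell2 u & E [set x | x < 0] u != 0.
  apply: contrapT => noneg.
  have E0 w : ell2 w -> E [set x | x < 0] w = 0.
    by move=> w2; apply: contrapT => /eqP Ew; apply: noneg; exists w.
  have vn0_gt0 : 0 < v n0 by rewrite lt_def vn0 v_ge0.
  have [r [M [n0M r0 energy]]] := critical alpha n0 _ a1 a0 vn0_gt0.
  have domr := dom_H_finite alpha v _ _ r0.
  have := Re_inner_H _ v _ _ a1 r0; rewrite formE //= => form.
  have : 0 <= fine (\int[scalar_measure E (real_seq r)]_x (x : R)%:E)%E.
    by apply: fine_ge0; apply: spectral_integral_ge0 => //; case: domr.
  rewrite form subr_ge0 leNgt => /negP; apply.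
  apply: (lt_le_trans energy); rewrite (bigD1 (Ordinal n0M)) //= lerDl.
  by apply: sumr_ge0 => i _; rewrite mulr_ge0 // sqr_ge0.
apply: ereal_sup_ubound; exists 1%N => //=.
exists (fun=> E [set x | x < 0] u); split; first by move=> _; exists u.
move=> c; rewrite big_ord1 => /eqP; rewrite scaler_eq0 (negbTE Eu) orbF => /eqP c0 i.
by rewrite (ord1 i).
Qed.
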